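(* Let $q\in\mathbb{C}$ with $0<|q|<1$, let $\alpha,\beta$ be positive integers, let $\chi$ be a Dirichlet character with odd conductor $d$, and let $n\ge0$ be an integer. Then for every $x\in\mathbb{C}$, $$\widetilde{\mathcal{E}}_{n,q}^{\chi}(x\mid\alpha:\beta)=\sum_{l=0}^{n}\binom{n}{l}\widetilde{\mathcal{E}}_{l,q}^{\chi}(\alpha:\beta)\sum_{j=0}^{l}\binom{l}{j}(q^{\alpha}-1)^{j}(n-l+j)!\,(-1)^{n-l+j}\sum_{m=0}^{\infty}\sum_{r=0}^{\infty}\binom{n-l+j+m-1}{m}\alpha^{r}q^{\alpha m}(\log q)^{r}\,\mathcal{S}(r,n-l+j)\frac{x^{r}}{r!}.$$
   Context: A value of $\log q$ is fixed, $q^{t}=\exp(t\log q)$, and $[y:Q]=\frac{Q^y-1}{Q-1}$ for $Q\ne1$. The Dirichlet type $q$-Euler polynomials with weight $\alpha$ and $\beta$ are $$\widetilde{\mathcal{E}}_{n,q}^{\chi}(x\mid\alpha:\beta)=\frac{[2:q^{\beta}]}{(1-q^{\alpha})^{n}}\sum_{j=0}^{n}\binom{n}{j}(-1)^{j}q^{\alpha jx}\sum_{l=0}^{d-1}\chi(l)(-1)^{l}\frac{q^{(\alpha j+\beta)l}}{1+q^{(\alpha j+\beta)d}},$$ and $\widetilde{\mathcal{E}}_{n,q}^{\chi}(\alpha:\beta):=\widetilde{\mathcal{E}}_{n,q}^{\chi}(0\mid\alpha:\beta)$. (This is the closed form of the fermionic $p$-adic integral $\int[x+\eta:q^\alpha]^n\chi(\eta)\,d\mu_{-q^\beta}(\eta)$,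 read for complex $q$.) $\mathcal{S}(r,k)$ are the Stirling numbers of the second kind, $\sum_{r\ge0}\mathcal{S}(r,k)\frac{t^{r}}{r!}=\frac{(e^{t}-1)^{k}}{k!}$. By convention, $\binom{m-1}{m}$ equals $1$ for $m=0$ and $0$ for $m\ge1$. *)

(* Defs.v *)
(* Binomial coefficients are MathComp's, on [nat]: unlike Stdlib's real-valued
   [Binomial.C], they vanish above the diagonal. *)
From Stdlib Require Import Reals ZArith Arith Lra.
From Coquelicot Require Import Coquelicot.
From mathcomp Require binomial.

Open Scope C_scope.

Notation "'binom'" := binomial.binomial (only parsing).

Definition CofN (n : nat) : C := RtoC (INR n).

Definition Cexp (z : C) : C :=
  ((exp (Re z) * cos (Im z))%R, (exp (Re z) * sin (Im z))%R).

(** [q^t] for complex [t], where [logq] is the chosen value of [log q]. *)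
Definition qpow (logq t : C) : C := Cexp (t * logq).

Definition qbracket (y : nat) (Q : C) : C := (Q ^ y - 1) / (Q - 1).

Definition dirichlet_character (N : nat) (chi : Z -> C) : Prop :=
  (0 < N)%nat /\
  (forall a : Z, chi (a + Z.of_nat N)%Z = chi a) /\
  (forall a b : Z, chi (a * b)%Z = chi a * chi b) /\
  (forall a : Z, chi a <> 0 <-> Z.gcd a (Z.of_nat N) = 1%Z).

(** [e] is an induced modulus of the character [chi] modulo [N]: on the
    residues prime to [N], [chi] factors through the units modulo [e]. *)
Definition induced_modulus (N : nat) (chi : Z -> C) (e : nat) : Prop :=
  (0 < e)%nat /\ Nat.divide e N /\
  forall a : Z,
    Z.gcd a (Z.of_nat N) = 1%Z -> Z.divide (Z.of_nat e) (a - 1)%Z -> chi a = 1.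

Definition conductor (N : nat) (chi : Z -> C) (d : nat) : Prop :=
  induced_modulus N chi d /\
  forall e : nat, induced_modulus N chi e -> (d <= e)%nat.

(** [qEuler q logq chi d alpha beta n x] is the n-th Dirichlet type q-Euler
    polynomial at [x]; beware that [sum_n f m] is the sum over [0, ..., m]. *)
Definition qEuler (q logq : C) (chi : Z -> C) (d alpha beta n : nat) (x : C)
  : C :=
  qbracket 2 (q ^ beta) / (1 - q ^ alpha) ^ n *
  sum_n (fun j : nat =>
    CofN (binom n j) * (- (1)) ^ j * qpow logq (CofN alpha * CofN j * x) *
    sum_n (fun l : nat =>
      chi (Z.of_nat l) * (- (1)) ^ l *
      (q ^ ((alpha * j + beta) * l) / (1 + q ^ ((alpha * j + beta) * d))))
      (d - 1)) n.

Definition qEuler_number (q logq : C) (chi : Z -> C) (d alpha beta n : nat)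
  : C :=
  qEuler q logq chi d alpha beta n 0.

(** [stirling2 r k / r!] is the coefficient of [t^r] in the formal power
    series [(e^t - 1)^k / k!]; [PS_mult] is the Cauchy product. *)
Definition PS_expm1 (r : nat) : R :=
  match r with O => 0%R | S _ => (/ INR (fact r))%R end.

Fixpoint PS_pow (a : nat -> R) (k : nat) : nat -> R :=
  match k with
  | O => fun r => match r with O => 1%R | S _ => 0%R end
  | S k' => PS_mult a (PS_pow a k')
  end.

Definition stirling2 (r k : nat) : R :=
  (INR (fact r) * (PS_pow PS_expm1 k r / INR (fact k)))%R.

Lemma is_pseries_PS_one (a : nat -> R) (t : R) : is_pseries (PS_pow a 0) t 1%R.
Proof.
apply is_pseries_R.
apply filterlim_ext with (f := fun _ : nat => 1%R); [|apply filterlim_const].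
intros n; induction n as [|n IHn].
- rewrite sum_O; simpl; ring.
- rewrite sum_Sn, <- IHn; unfold plus; simpl; ring.
Qed.

Lemma is_pseries_PS_expm1 (t : R) : is_pseries PS_expm1 t (exp t - 1)%R.
Proof.
apply is_pseries_ext with
  (PS_minus (fun n => (/ INR (fact n))%R) (PS_pow PS_expm1 0)).
- intros [|n]; unfold PS_minus, PS_plus, PS_opp, plus, opp; simpl; field.
  apply (INR_fact_neq_0 (S n)).
- exact (is_pseries_minus _ _ _ _ _ (is_exp_Reals t)
           (is_pseries_PS_one PS_expm1 t)).
Qed.

Lemma CV_radius_everywhere (a : nat -> R) :
  (forall t : R, ex_pseries a t) -> CV_radius a = p_infty.
Proof.
intros Ha.
destruct (Rbar_le_lt_or_eq_dec (CV_radius a) p_infty) as [Hlt|Heq];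
  [destruct (CV_radius a); easy| |exact Heq].
exfalso.
set (t := (real (CV_radius a) + 1)%R).
assert (H : Rbar_lt (CV_radius a) (Rabs t)).
{ unfold t; generalize (CV_radius_ge_0 a).
  destruct (CV_radius a) as [r| |]; simpl in *; try easy.
  intros Hr; rewrite Rabs_pos_eq; lra. }
apply (CV_disk_outside _ _ H).
apply ex_series_lim_0.
apply ex_pseries_R, Ha.
Qed.

Lemma is_pseries_PS_pow (k : nat) (t : R) :
  is_pseries (PS_pow PS_expm1 k) t ((exp t - 1) ^ k)%R.
Proof.
revert t; induction k as [|k IHk]; intros t.
- apply is_pseries_PS_one.
- apply is_pseries_mult; [apply is_pseries_PS_expm1|apply IHk| |].
  + rewrite CV_radius_everywhere; [easy|].
    intros u; eexists; apply is_pseries_PS_expm1.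
  + rewrite CV_radius_everywhere; [easy|].
    intros u; eexists; apply IHk.
Qed.

Lemma stirling2_generating_function (k : nat) (t : R) :
  is_series (fun r => stirling2 r k * (t ^ r / INR (fact r)))%R
            ((exp t - 1) ^ k / INR (fact k))%R.
Proof.
assert (H := is_pseries_PS_pow k t).
apply is_pseries_R in H.
apply (is_series_scal_r (/ INR (fact k))%R) in H.
apply is_series_ext with (2 := H).
intros r; unfold stirling2; simpl.
field; split; apply INR_fact_neq_0.
Qed.

Definition Cex_series (a : nat -> C) : Prop :=
  @ex_series C_AbsRing C_NormedModule a.

(** The sum of a convergent series (see [CSeries_unique]), computed on real and
    imaginary parts because [Series] is only defined over [R]. *)
Definition CSeries (a : nat -> C) : C :=
  (Series (fun n => Re (a n)), Series (fun n => Im (a n))).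

Lemma CSeries_unique (a : nat -> C) (s : C) :
  @is_series C_AbsRing C_NormedModule a s -> CSeries a = s.
Proof.
intros H.
assert (Hsum : forall n, @sum_n C_NormedModule a n =
                 (sum_n (fun i => Re (a i)) n, sum_n (fun i => Im (a i)) n)).
{ intros n; induction n as [|n IHn].
  - rewrite !sum_O; now destruct (a O).
  - rewrite !sum_Sn, IHn; now destruct (a (S n)). }
destruct s as [u v]; unfold CSeries; f_equal; apply is_series_unique;
  intros P [eps He].
- destruct (H (fun z => P (Re z))) as [n Hn].
  { exists eps; intros y Hy; apply He, Hy. }
  exists n; intros m Hm; specialize (Hn m Hm); rewrite Hsum in Hn; exact Hn.
- destruct (H (fun z => P (Im z))) as [n Hn].
  { exists eps; intros y Hy; apply He, Hy. }
  exists n; intros m Hm; specialize (Hn m Hm); rewrite Hsum in Hn; exact Hn.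
Qed.

(* Main.v *)
Require Import Defs.
From Stdlib Require Import Reals ZArith Arith Lia Lra.
From Coquelicot Require Import Coquelicot.
From mathcomp Require binomial.
Open Scope C_scope.

(** Put [Q = q^alpha] and [T = q^(alpha x)].

    The double series splits.  For fixed [m] the sum over [r] is the exponential
    generating function of the Stirling numbers at the complex number
    [alpha x log q], namely [(e^z - 1)^k / k!] with [e^z = T]; what remains is
    the negative binomial series of [(1 - Q)^(-k)], which converges as
    [|Q| < 1].  Hence the double series is [(T - 1)^k / (k! (1 - Q)^k)]
    ([double_series_inner], [double_series_outer]).

    After this substitution the powers of [1 - Q] in the sum over [j] recombine
    and leave [((1 - T) / (1 - Q))^(n - l)] times the binomial expansion of
    [(1 + (T - 1))^l = T^l] ([inner_sum_eq]).  The right-hand side becomes the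
    addition formula, the sum over [l] of
    [binom n l * E_l * [x : Q]^(n - l) * T^l].

    To prove the latter, write [E_n(x)] as [A / (1 - Q)^n] times the sum over [j]
    of [binom n j * T^j * c_j], where [c_j] depends neither on [n] nor on [x].
    The claim is then an instance of the composition law of weighted binomial
    transforms ([binomial_sum_comp]): transforming with weights [(1, 1)] and then
    with [(1 - T, T)] is transforming with
    [((1 - T) + T * 1, T * 1) = (1, T)].

    For the analysis, the two complex power series come from one principle, the
    Cauchy product [is_Cseries_PS_mult]: [(e^z - 1)^k] is a power of the
    exponential series minus one, and [(1 - w)^(-k)] is a power of the geometric
    series. *)

(** * Series of complex numbers *)

Notation is_Cseries := (@is_series C_AbsRing C_NormedModule).

(** A sum over [C] has type [C] only up to conversion, and [ring] matches types
    syntactically. *)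
Ltac ring_C := lazymatch goal with |- ?a = ?b => change (@eq C a b); ring end.

Lemma sum_n_C (a : nat -> C) (n : nat) :
  @sum_n C_AbelianMonoid a n =
  (sum_n (fun i => Re (a i)) n, sum_n (fun i => Im (a i)) n).
Proof.
induction n as [|n IHn].
- rewrite !sum_O; now destruct (a O).
- rewrite !sum_Sn, IHn; now destruct (a (S n)).
Qed.

Lemma sum_n_C_plus (a b : nat -> C) (n : nat) :
  @sum_n C_AbelianMonoid (fun l => a l + b l) n =
  @sum_n C_AbelianMonoid a n + @sum_n C_AbelianMonoid b n.
Proof. exact (@sum_n_plus C_AbelianMonoid a b n). Qed.

Lemma sum_n_C_mult_l (c : C) (a : nat -> C) (n : nat) :
  @sum_n C_AbelianMonoid (fun l => c * a l) n =
  c * @sum_n C_AbelianMonoid a n.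
Proof. exact (@sum_n_mult_l C_Ring c a n). Qed.

Lemma sum_n_C_shift (a : nat -> C) (n : nat) :
  @sum_n C_AbelianMonoid a (S n) =
  a O + @sum_n C_AbelianMonoid (fun l => a (S l)) n.
Proof.
induction n as [|n IHn].
- now rewrite sum_Sn, !sum_O.
- rewrite sum_Sn, IHn, sum_Sn; unfold plus; simpl; ring.
Qed.

Lemma is_Cseries_Re_Im (a : nat -> C) (s : C) :
  is_series (fun n => Re (a n)) (Re s) ->
  is_series (fun n => Im (a n)) (Im s) ->
  is_Cseries a s.
Proof.
intros HR HI; apply filterlim_locally; intros eps.
assert (HR' := proj1 (filterlim_locally _ _) HR eps).
assert (HI' := proj1 (filterlim_locally _ _) HI eps).
generalize (filter_and _ _ HR' HI'); apply filter_imp.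
intros n [H1 H2].
change (@ball C_UniformSpace s eps (@sum_n C_AbelianMonoid a n)).
rewrite sum_n_C; split; assumption.
Qed.

Lemma is_Cseries_inv (a : nat -> C) (s : C) :
  is_Cseries a s ->
  is_series (fun n => Re (a n)) (Re s) /\ is_series (fun n => Im (a n)) (Im s).
Proof.
intros H.
assert (H' := proj1 (filterlim_locally _ _) H).
split; apply filterlim_locally; intros eps; generalize (H' eps);
  apply filter_imp; intros n Hn;
  change (@ball C_UniformSpace s eps (@sum_n C_AbelianMonoid a n)) in Hn;
  rewrite sum_n_C in Hn; apply Hn.
Qed.

Lemma im_le_Cmod (z : C) : (Rabs (Im z) <= Cmod z)%R.
Proof. exact (Rle_trans _ _ _ (Rmax_r _ _) (Rmax_Cmod z)). Qed.

(** The form in which convergence is checked when the partial sums have a closed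
    form. *)
Lemma is_Cseries_remainder (a : nat -> C) (s : C) :
  is_lim_seq (fun n => Cmod (@sum_n C_AbelianMonoid a n - s)) 0%R ->
  is_Cseries a s.
Proof.
intros H.
assert (Hpart : forall f : C -> R, (forall w, Rabs (f w) <= Cmod w)%R ->
  (forall n, f (@sum_n C_AbelianMonoid a n - s) =
    (sum_n (fun i => f (a i)) n - f s)%R) ->
  is_series (fun i => f (a i)) (f s)).
{ intros f Hf Hn.
  change (is_lim_seq (sum_n (fun i => f (a i))) (f s)).
  apply is_lim_seq_ext with
    (fun n => f (@sum_n C_AbelianMonoid a n - s)%C + f s)%R.
  { intros n; rewrite Hn; ring. }
  replace (Finite (f s)) with (Finite (0 + f s)) by (f_equal; ring).
  apply is_lim_seq_plus'; [|apply is_lim_seq_const].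
  apply is_lim_seq_abs_0.
  apply is_lim_seq_le_le with (3 := H) (u := fun _ => 0%R);
    [|apply is_lim_seq_const].
  intros n; split; [apply Rabs_pos|apply Hf]. }
apply is_Cseries_Re_Im; apply Hpart;
  [apply re_le_Cmod| |apply im_le_Cmod|]; intros n; rewrite sum_n_C;
  reflexivity.
Qed.

(** Mertens' theorem, reduced to the real one: the real and imaginary parts of
    the product are combinations of Cauchy products of the real and imaginary
    parts of the factors, all of which converge absolutely inside the disks of
    convergence. *)
Lemma is_Cseries_PS_mult (a b : nat -> R) (z A B : C) :
  Rbar_lt (Cmod z) (CV_radius a) -> Rbar_lt (Cmod z) (CV_radius b) ->
  is_Cseries (fun n => RtoC (a n) * z ^ n) A ->
  is_Cseries (fun n => RtoC (b n) * z ^ n) B ->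
  is_Cseries (fun n => RtoC (PS_mult a b n) * z ^ n) (A * B).
Proof.
intros Ha Hb HA HB.
destruct (is_Cseries_inv _ _ HA) as [HA1 HA2].
destruct (is_Cseries_inv _ _ HB) as [HB1 HB2].
assert (Habs : forall (c : nat -> R) (f : C -> R),
  Rbar_lt (Cmod z) (CV_radius c) ->
  (forall w, Rabs (f w) <= Cmod w)%R ->
  ex_series (fun n => Rabs (f (RtoC (c n) * z ^ n)))).
{ intros c f Hc Hf.
  rewrite <- (Rabs_pos_eq (Cmod z)) in Hc by apply Cmod_ge_0.
  eapply (@ex_series_le R_AbsRing R_CompleteNormedModule);
    [|exact (CV_disk_inside _ _ Hc)].
  intros n; change (Rabs (Rabs (f (RtoC (c n) * z ^ n)%C)) <=
    Rabs (c n * Cmod z ^ n))%R.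
  rewrite Rabs_Rabsolu, Rabs_mult, <- RPow_abs, (Rabs_pos_eq (Cmod z)),
    <- Cmod_pow, <- (Cmod_R (c n)), <- Cmod_mult by apply Cmod_ge_0.
  apply Hf. }
assert (Ha1 := Habs a Re Ha re_le_Cmod).
assert (Ha2 := Habs a Im Ha im_le_Cmod).
assert (Hb1 := Habs b Re Hb re_le_Cmod).
assert (Hb2 := Habs b Im Hb im_le_Cmod).
assert (Hprod : forall n, RtoC (PS_mult a b n) * z ^ n =
  @sum_n C_AbelianMonoid (fun k => RtoC (a k) * z ^ k *
    (RtoC (b (n - k)%nat) * z ^ (n - k))) n).
{ intros n; unfold PS_mult; rewrite <- sum_n_Reals.
  transitivity (@sum_n C_AbelianMonoid
    (fun k => z ^ n * RtoC (a k * b (n - k)%nat)) n).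
  - rewrite (@sum_n_mult_l C_Ring).
    unfold mult; simpl; rewrite Cmult_comm; f_equal.
    rewrite sum_n_C; apply injective_projections; simpl.
    + now apply sum_n_ext.
    + rewrite sum_n_const; simpl; ring.
  - apply sum_n_ext_loc; intros k Hk.
    replace n with (k + (n - k))%nat at 1 by lia.
    rewrite Cpow_add_r, RtoC_mult; ring_C. }
apply is_Cseries_Re_Im.
- apply is_series_ext with (2 := is_series_minus _ _ _ _
    (is_series_mult _ _ _ _ HA1 HB1 Ha1 Hb1)
    (is_series_mult _ _ _ _ HA2 HB2 Ha2 Hb2)).
  intros n; rewrite Hprod, sum_n_C; cbn [fst Re]; rewrite sum_n_Reals.
  exact (eq_sym (minus_sum _ _ n)).
- apply is_series_ext with (2 := is_series_plus _ _ _ _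
    (is_series_mult _ _ _ _ HA1 HB2 Ha1 Hb2)
    (is_series_mult _ _ _ _ HA2 HB1 Ha2 Hb1)).
  intros n; rewrite Hprod, sum_n_C; cbn [snd Im]; rewrite sum_n_Reals.
  exact (eq_sym (plus_sum _ _ n)).
Qed.

(** Convergence at the positive real points of a disk already bounds the radius
    of convergence from below, so a sum known on a complex disk supplies the hypothesis of
    [is_Cseries_PS_mult]. *)
Lemma CV_radius_ge_of_Cseries (a : nat -> R) (rho : R) :
  (forall w, (Cmod w < rho)%R ->
     exists s, is_Cseries (fun n => RtoC (a n) * w ^ n) s) ->
  Rbar_le rho (CV_radius a).
Proof.
intros H; apply Rbar_not_lt_le; intros Hlt.
assert (Hpos := CV_radius_ge_0 a).
destruct (CV_radius a) as [r| |] eqn:Er; try easy; simpl in *.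
set (t := ((r + rho) / 2)%R).
assert (Ht : Rbar_lt (CV_radius a) (Rabs t)).
{ rewrite Er; simpl; unfold t; rewrite Rabs_pos_eq; lra. }
apply (CV_disk_outside _ _ Ht).
destruct (H (RtoC t)) as [s Hs].
{ rewrite Cmod_R; unfold t; rewrite Rabs_pos_eq; lra. }
apply ex_series_lim_0; exists (Re s).
eapply is_series_ext; [|exact (proj1 (is_Cseries_inv _ _ Hs))].
intros n; simpl; rewrite <- RtoC_pow; simpl; ring.
Qed.

(** * The complex exponential *)

Lemma Cexp_0 : Cexp 0 = 1.
Proof.
unfold Cexp; simpl; rewrite exp_0, cos_0, sin_0.
apply injective_projections; simpl; ring.
Qed.

Lemma Cexp_plus (z w : C) : Cexp (z + w) = Cexp z * Cexp w.
Proof.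
unfold Cexp; destruct z as [a b], w as [c d]; simpl.
rewrite exp_plus, cos_plus, sin_plus.
apply injective_projections; simpl; ring.
Qed.

Lemma Cexp_mult_nat (z : C) (n : nat) : Cexp (CofN n * z) = Cexp z ^ n.
Proof.
induction n as [|n IHn].
- unfold CofN; simpl; rewrite Cmult_0_l; apply Cexp_0.
- rewrite Cpow_S, <- IHn, <- Cexp_plus; apply f_equal.
  unfold CofN; rewrite S_INR, RtoC_plus; ring.
Qed.

Lemma Cmod_Cexp (z : C) : Cmod (Cexp z) = exp (Re z).
Proof.
unfold Cmod, Cexp; simpl.
replace (_ + _)%R with (exp (Re z) * exp (Re z))%R.
- apply sqrt_square, Rlt_le, exp_pos.
- assert (H := sin2_cos2 (Im z)); unfold Rsqr in H.
  transitivity (exp (Re z) * exp (Re z) *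
    (sin (Im z) * sin (Im z) + cos (Im z) * cos (Im z)))%R; [rewrite H|]; ring.
Qed.

Lemma is_derive_Re_Cexp (c z : C) (t : R) :
  is_derive (fun t => Re (c * Cexp (RtoC t * z))) t
            (Re (c * z * Cexp (RtoC t * z))).
Proof.
destruct c as [c1 c2], z as [z1 z2].
unfold Cexp, Cmult, RtoC, Re, Im; simpl.
auto_derive; [easy|unfold Rminus; ring].
Qed.

Lemma Derive_n_Re_Cexp (c z : C) (n : nat) (t : R) :
  Derive_n (fun t => Re (c * Cexp (RtoC t * z))) n t =
  Re (c * z ^ n * Cexp (RtoC t * z)).
Proof.
revert t; induction n as [|n IHn]; intros t.
- now rewrite Cmult_1_r.
- change (Derive_n ?f (S n) t) with (Derive (Derive_n f n) t).
  rewrite (Derive_ext _ _ _ IHn).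
  transitivity (Re (c * z ^ n * z * Cexp (RtoC t * z))).
  + apply is_derive_unique, is_derive_Re_Cexp.
  + apply f_equal; rewrite Cpow_S; ring.
Qed.

(** Taylor's formula on [[0, 1]] for the real function [t |-> Re (c e^(t z))],
    whose derivatives are explicit and bounded by [|c| |z|^n e^|Re z|].  The
    factor [c] gives the real part of [e^z] for [c = 1] and the imaginary part
    for [c = -i]. *)
Lemma is_series_Re_Cexp (c z : C) :
  is_series (fun n => Re (c * z ^ n) / INR (fact n))%R (Re (c * Cexp z)).
Proof.
set (f := fun t : R => Re (c * Cexp (RtoC t * z))).
set (r := fun n => (Re (c * Cexp z) -
  sum_n (fun n => Re (c * z ^ n) / INR (fact n)) n)%R).
(* The remainder of order [n] contains [|z|^(n + 1) / (n + 1)!]; bounding its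
   denominator below by [n!] puts the extra factor [|z|] into [M]. *)
set (M := (Cmod c * Cmod z * exp (Rabs (Re z)))%R).
assert (Hr : forall n, (Rabs (r n) <= M * (Cmod z ^ n / INR (fact n)))%R).
{ intros n.
  destruct (Taylor_Lagrange f n 0 1) as [zeta [Hz Hf]]; [lra| |].
  { intros t _ [|k] _; [easy|]; simpl.
    apply ex_derive_ext with (fun t => Re (c * z ^ k * Cexp (RtoC t * z))).
    - intros u; symmetry; apply Derive_n_Re_Cexp.
    - eexists; apply is_derive_Re_Cexp. }
  assert (Hrn : r n = (Re (c * z ^ S n * Cexp (RtoC zeta * z))
                       / INR (fact (S n)))%R).
  { unfold r; rewrite sum_n_Reals.
    replace (Re (c * Cexp z)) with (f 1%R); [|unfold f; now rewrite Cmult_1_l].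
    rewrite Hf; unfold f at 2; rewrite Derive_n_Re_Cexp.
    rewrite (sum_eq _ (fun n => Re (c * z ^ n) / INR (fact n))%R).
    - replace (1 - 0)%R with 1%R by ring; rewrite pow1; field.
      apply INR_fact_neq_0.
    - intros i _; unfold f; rewrite Derive_n_Re_Cexp.
      replace (1 - 0)%R with 1%R by ring; rewrite pow1, Cmult_0_l.
      rewrite Cexp_0, Cmult_1_r; field; apply INR_fact_neq_0. }
  rewrite Hrn; unfold Rdiv.
  rewrite Rabs_mult, (Rabs_pos_eq (/ _)).
  2: apply Rlt_le, Rinv_0_lt_compat, INR_fact_lt_0.
  rewrite <- Rmult_assoc.
  apply Rmult_le_compat; [apply Rabs_pos| | |].
  - apply Rlt_le, Rinv_0_lt_compat, INR_fact_lt_0.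
  - eapply Rle_trans; [apply re_le_Cmod|].
    rewrite !Cmod_mult, Cmod_Cexp, Cmod_pow; unfold M; simpl.
    replace (Cmod c * Cmod z * exp (Rabs (Re z)) * Cmod z ^ n)%R with
      (Cmod c * (Cmod z * Cmod z ^ n) * exp (Rabs (Re z)))%R by ring.
    apply Rmult_le_compat_l.
    + repeat apply Rmult_le_pos; try apply Cmod_ge_0.
      apply pow_le, Cmod_ge_0.
    + apply Rnot_lt_le; intros Hlt; apply exp_lt_inv in Hlt.
      generalize (Rle_abs (fst z)) (Rabs_pos (fst z)); unfold Re in Hlt.
      intros; nra.
  - apply Rinv_le_contravar; [apply INR_fact_lt_0|].
    apply le_INR, fact_le; lia. }
assert (Hr0 : is_lim_seq r 0%R).
{ apply is_lim_seq_abs_0.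
  apply is_lim_seq_le_le with (fun _ => 0%R)
    (fun n => (M * (Cmod z ^ n / INR (fact n)))%R).
  - intros n; split; [apply Rabs_pos|apply Hr].
  - apply is_lim_seq_const.
  - replace (Finite 0) with (Rbar_mult M 0%R) by (simpl; f_equal; ring).
    apply is_lim_seq_scal_l, is_lim_seq_Reals, cv_speed_pow_fact. }
change (is_lim_seq (sum_n (fun n => Re (c * z ^ n) / INR (fact n))%R)
  (Re (c * Cexp z))).
apply (is_lim_seq_ext (fun n => (Re (c * Cexp z) - r n)%R)).
- intros n; unfold r; ring.
- replace (Finite (Re (c * Cexp z))) with (Finite (Re (c * Cexp z) - 0))
    by (f_equal; ring).
  apply is_lim_seq_minus'; [apply is_lim_seq_const|exact Hr0].
Qed.

Lemma is_Cseries_Cexp (z : C) :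
  is_Cseries (fun n => RtoC (/ INR (fact n)) * z ^ n) (Cexp z).
Proof.
apply is_Cseries_Re_Im.
- apply is_series_ext with (fun n => Re (1 * z ^ n) / INR (fact n))%R.
  + intros n; rewrite Cmult_1_l; destruct (z ^ n) as [u v]; simpl; field.
    apply INR_fact_neq_0.
  + rewrite <- (Cmult_1_l (Cexp z)); apply is_series_Re_Cexp.
- apply is_series_ext with (fun n => Re (- Ci * z ^ n) / INR (fact n))%R.
  + intros n; destruct (z ^ n) as [u v]; simpl; field.
    apply INR_fact_neq_0.
  + replace (Im (Cexp z)) with (Re (- Ci * Cexp z)) by (simpl; ring).
    apply is_series_Re_Cexp.
Qed.

(** * The generating function of the Stirling numbers *)

Lemma is_Cseries_PS_one (a : nat -> R) (z : C) :
  is_Cseries (fun n => RtoC (PS_pow a 0 n) * z ^ n) (RtoC 1).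
Proof.
apply is_Cseries_remainder.
apply is_lim_seq_ext with (fun _ => 0%R); [|apply is_lim_seq_const].
intros n; symmetry; rewrite <- Cmod_0; f_equal.
induction n as [|n IHn].
- rewrite sum_O; simpl; ring.
- rewrite sum_Sn; unfold plus; simpl.
  transitivity (@sum_n C_AbelianMonoid
    (fun n => RtoC (PS_pow a 0 n) * z ^ n) n - 1); [simpl; ring|exact IHn].
Qed.

Lemma is_Cseries_PS_expm1 (z : C) :
  is_Cseries (fun n => RtoC (PS_expm1 n) * z ^ n) (Cexp z - 1).
Proof.
eapply is_series_ext;
  [|exact (is_series_minus _ _ _ _ (is_Cseries_Cexp z)
             (is_Cseries_PS_one PS_expm1 z))].
intros [|n]; unfold plus, opp; simpl.
- rewrite Rinv_1; ring.
- ring.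
Qed.

Lemma is_Cseries_PS_pow_expm1 (k : nat) (z : C) :
  is_Cseries (fun n => RtoC (PS_pow PS_expm1 k n) * z ^ n) ((Cexp z - 1) ^ k).
Proof.
induction k as [|k IHk].
- apply is_Cseries_PS_one.
- apply is_Cseries_PS_mult; [| |apply is_Cseries_PS_expm1|exact IHk].
  + rewrite CV_radius_everywhere; [easy|].
    intros t; eexists; apply is_pseries_PS_expm1.
  + rewrite CV_radius_everywhere; [easy|].
    intros t; eexists; apply is_pseries_PS_pow.
Qed.

Lemma CofN_fact_neq_0 (n : nat) : CofN (fact n) <> 0.
Proof. intros H; apply RtoC_inj in H; exact (INR_fact_neq_0 n H). Qed.

Lemma stirling2_generating_function_C (k : nat) (z : C) :
  is_Cseries (fun r => RtoC (stirling2 r k) * (z ^ r / CofN (fact r)))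
             ((Cexp z - 1) ^ k / CofN (fact k)).
Proof.
eapply is_series_ext;
  [|unfold Cdiv; rewrite Cmult_comm;
    exact (is_series_scal _ _ _ (is_Cseries_PS_pow_expm1 k z))].
intros r; unfold scal, stirling2; simpl; unfold mult; simpl.
fold (CofN (fact k)) (CofN (fact r)).
rewrite !RtoC_mult, RtoC_div by apply INR_fact_neq_0.
fold (CofN (fact k)) (CofN (fact r)).
field; split; apply CofN_fact_neq_0.
Qed.

(** * The negative binomial series *)

(** The truncated subtraction is harmless: for [k = m = 0] it gives
    [binom 0 0 = 1], the conventional value. *)
Definition negbin (k m : nat) : R := INR (binom (k + m - 1) m).

(** Hockey-stick identity: multiplying by the geometric series sums the
    coefficients, and by Pascal's rule the sums of the [k]-th row are the
    coefficients of the next one. *)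
Lemma PS_mult_negbin_one (k m : nat) :
  PS_mult (negbin k) (fun _ => 1%R) m = negbin (S k) m.
Proof.
unfold PS_mult; induction m as [|m IHm].
- simpl; unfold negbin; rewrite !binomial.bin0; simpl; ring.
- simpl sum_f_R0; rewrite IHm; unfold negbin.
  replace (S k + S m - 1)%nat with (S (k + m)) by lia.
  replace (k + S m - 1)%nat with (k + m)%nat by lia.
  replace (S k + m - 1)%nat with (k + m)%nat by lia.
  rewrite binomial.binS.
  change ssrnat.addn with Nat.add; rewrite plus_INR; ring.
Qed.

Lemma one_minus_neq_0 (w : C) : (Cmod w < 1)%R -> 1 - w <> 0.
Proof.
intros Hw H; assert (Hw1 : w = 1) by (rewrite <- (Cplus_0_l w), <- H; ring).
rewrite Hw1, Cmod_1 in Hw; lra.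
Qed.

Lemma is_Cseries_geom (w : C) :
  (Cmod w < 1)%R -> is_Cseries (fun n => RtoC 1 * w ^ n) (/ (1 - w)).
Proof.
intros Hw.
assert (H1w := one_minus_neq_0 w Hw).
assert (Hsum : forall n,
  @sum_n C_AbelianMonoid (fun n => RtoC 1 * w ^ n) n - / (1 - w) =
  - (w ^ n * (w * / (1 - w)))).
{ induction n as [|n IHn].
  - rewrite sum_O; simpl; field; exact H1w.
  - rewrite sum_Sn; unfold plus; simpl.
    transitivity (@sum_n C_AbelianMonoid (fun n => RtoC 1 * w ^ n) n -
      / (1 - w) + w * w ^ n); [simpl; ring|].
    rewrite IHn; field; exact H1w. }
apply is_Cseries_remainder.
apply is_lim_seq_ext with (fun n => Cmod w ^ n * (Cmod w * / Cmod (1 - w)))%R.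
- intros n; rewrite Hsum, Cmod_opp, !Cmod_mult, Cmod_pow, Cmod_inv;
    [reflexivity|exact H1w].
- replace (Finite 0) with (Rbar_mult 0%R (Cmod w * / Cmod (1 - w))%R)
    by (simpl; f_equal; ring).
  apply is_lim_seq_scal_r, is_lim_seq_geom.
  rewrite Rabs_pos_eq; [exact Hw|apply Cmod_ge_0].
Qed.

Lemma is_Cseries_negbin (k : nat) (w : C) :
  (Cmod w < 1)%R ->
  is_Cseries (fun m => RtoC (negbin k m) * w ^ m) ((/ (1 - w)) ^ k).
Proof.
revert w; induction k as [|k IHk]; intros w Hw.
- eapply is_series_ext; [|exact (is_Cseries_PS_one PS_expm1 w)].
  intros [|m]; unfold negbin; simpl.
  + reflexivity.
  + replace (m - 0)%nat with m by lia.
    rewrite binomial.bin_small; [reflexivity|apply ssrnat.leqnn].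
- eapply is_series_ext.
  + intros m; rewrite <- PS_mult_negbin_one; reflexivity.
  + rewrite Cpow_S, Cmult_comm.
    apply is_Cseries_PS_mult;
      [| |exact (IHk w Hw)|exact (is_Cseries_geom w Hw)].
    * apply Rbar_lt_le_trans with 1%R; [exact Hw|].
      apply CV_radius_ge_of_Cseries; intros v Hv; eexists; exact (IHk v Hv).
    * apply Rbar_lt_le_trans with 1%R; [exact Hw|].
      apply CV_radius_ge_of_Cseries; intros v Hv; eexists.
      exact (is_Cseries_geom v Hv).
Qed.

(** * Weighted binomial transforms *)

Definition binomial_sum (s t : C) (b : nat -> C) (n : nat) : C :=
  sum_n (fun l => CofN (binom n l) * (s ^ (n - l) * t ^ l * b l)) n.

(** Pascal's rule, summed. *)
Lemma sum_n_binomial_pascal (F : nat -> C) (n : nat) :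
  @sum_n C_AbelianMonoid (fun l => CofN (binom (S n) l) * F l) (S n) =
  @sum_n C_AbelianMonoid (fun l => CofN (binom n l) * F l) n +
  @sum_n C_AbelianMonoid (fun l => CofN (binom n l) * F (S l)) n.
Proof.
rewrite sum_n_C_shift.
rewrite (sum_n_ext (G := C_AbelianMonoid) _ (fun l =>
  CofN (binom n (S l)) * F (S l) + CofN (binom n l) * F (S l))).
- rewrite sum_n_C_plus, Cplus_assoc; f_equal.
  transitivity (@sum_n C_AbelianMonoid (fun l => CofN (binom n l) * F l) (S n)).
  + rewrite sum_n_C_shift, !binomial.bin0; reflexivity.
  + rewrite sum_Sn; unfold plus; simpl.
    rewrite (@binomial.bin_small n (S n)) by apply ssrnat.leqnn.
    unfold CofN; simpl; ring.
- intros l; rewrite binomial.binS.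
  change ssrnat.addn with Nat.add; unfold CofN; rewrite plus_INR, RtoC_plus.
  ring_C.
Qed.

(** The recursion that makes induction on [n] possible: it trades [n] for a
    shift of the sequence. *)
Lemma binomial_sum_S (s t : C) (b : nat -> C) (n : nat) :
  binomial_sum s t b (S n) =
  s * binomial_sum s t b n + t * binomial_sum s t (fun l => b (S l)) n.
Proof.
unfold binomial_sum.
rewrite (sum_n_binomial_pascal (fun l => s ^ (S n - l) * t ^ l * b l)).
rewrite <- !sum_n_C_mult_l; f_equal.
- apply sum_n_ext_loc; intros l Hl.
  rewrite (Nat.sub_succ_l _ _ Hl), Cpow_S; ring_C.
- apply sum_n_ext; intros l; rewrite Nat.sub_succ, Cpow_S; ring_C.
Qed.

Lemma binomial_sum_0 (s t : C) (a : nat -> C) : binomial_sum s t a 0 = a O.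
Proof.
unfold binomial_sum; rewrite sum_O, binomial.bin0.
unfold CofN; simpl; ring.
Qed.

Lemma binomial_sum_ext (s t : C) (a b : nat -> C) (n : nat) :
  (forall l, a l = b l) -> binomial_sum s t a n = binomial_sum s t b n.
Proof.
intros H; apply sum_n_ext; intros l; now rewrite H.
Qed.

Lemma binomial_sum_linear (s t u v : C) (a b : nat -> C) (n : nat) :
  binomial_sum s t (fun l => u * a l + v * b l) n =
  u * binomial_sum s t a n + v * binomial_sum s t b n.
Proof.
unfold binomial_sum; rewrite <- !sum_n_C_mult_l, <- sum_n_C_plus.
apply sum_n_ext; intros l; ring_C.
Qed.

(** In terms of the shift [S] on sequences, the transform with weights [(s, t)]
    is the [n]-th power of [s + t S] at index [0]; substituting [u + v S] for [S]
    in it gives [(s + t u) + t v S]. *)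
Lemma binomial_sum_comp (s t u v : C) (a : nat -> C) (n : nat) :
  binomial_sum s t (binomial_sum u v a) n =
  binomial_sum (s + t * u) (t * v) a n.
Proof.
revert a; induction n as [|n IHn]; intros a.
- now rewrite !binomial_sum_0.
- rewrite !binomial_sum_S.
  rewrite (binomial_sum_ext _ _ (fun l => binomial_sum u v a (S l)) (fun l =>
    u * binomial_sum u v a l + v * binomial_sum u v (fun i => a (S i)) l)).
  + rewrite binomial_sum_linear, !IHn; ring.
  + intros l; apply binomial_sum_S.
Qed.

Lemma binomial_sum_one (s t : C) (n : nat) :
  binomial_sum s t (fun _ => 1) n = (s + t) ^ n.
Proof.
induction n as [|n IHn].
- exact (binomial_sum_0 s t (fun _ => 1)).
- rewrite binomial_sum_S, IHn, Cpow_S; ring.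
Qed.

(** * The expansion of the q-Euler polynomials *)

(** All dependence on [x] sits in the second weight, so the q-Euler numbers are
    the case of weights [(1, 1)]. *)
Lemma qEuler_eq_binomial_sum
  (q logq : C) (chi : Z -> C) (d alpha beta n : nat) (x : C) :
  qEuler q logq chi d alpha beta n x =
  qbracket 2 (q ^ beta) / (1 - q ^ alpha) ^ n *
  binomial_sum 1 (qpow logq (CofN alpha * x)) (fun j =>
    (- (1)) ^ j * sum_n (fun l : nat =>
      chi (Z.of_nat l) * (- (1)) ^ l *
      (q ^ ((alpha * j + beta) * l) / (1 + q ^ ((alpha * j + beta) * d))))
      (d - 1)) n.
Proof.
unfold qEuler, binomial_sum; apply f_equal.
apply sum_n_ext; intros j.
replace (qpow logq (CofN alpha * CofN j * x)) with
  (qpow logq (CofN alpha * x) ^ j).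
- rewrite Cpow_1_l; ring_C.
- unfold qpow; rewrite <- Cexp_mult_nat; f_equal; ring.
Qed.

(** The powers [alpha^r], [(log q)^r] and [x^r] make up [(alpha x log q)^r], so
    that the exponential producing [q^(alpha x)] appears. *)
Lemma double_series_inner (q logq x : C) (alpha k m : nat) :
  is_Cseries (fun r =>
    CofN (binom (k + m - 1) m) * CofN alpha ^ r * q ^ (alpha * m) *
    logq ^ r * RtoC (stirling2 r k) * (x ^ r / CofN (fact r)))
  (RtoC (negbin k m) * (q ^ alpha) ^ m *
    ((qpow logq (CofN alpha * x) - 1) ^ k / CofN (fact k))).
Proof.
unfold qpow; set (z := CofN alpha * x * logq).
eapply is_series_ext;
  [|exact (is_series_scal (RtoC (negbin k m) * (q ^ alpha) ^ m) _ _
             (stirling2_generating_function_C k z))].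
intros r; unfold scal; simpl; unfold mult; simpl; unfold z.
rewrite !Cpow_mult_l, Cpow_mult_r; unfold negbin.
fold (CofN (binom (k + m - 1) m)).
unfold Cdiv; ring_C.
Qed.

Lemma double_series_outer (T Q : C) (k : nat) :
  (Cmod Q < 1)%R ->
  is_Cseries (fun m =>
    RtoC (negbin k m) * Q ^ m * ((T - 1) ^ k / CofN (fact k)))
  ((T - 1) ^ k / (CofN (fact k) * (1 - Q) ^ k)).
Proof.
intros HQ; assert (HQ1 := one_minus_neq_0 Q HQ).
replace ((T - 1) ^ k / (CofN (fact k) * (1 - Q) ^ k)) with
  ((T - 1) ^ k / CofN (fact k) * (/ (1 - Q)) ^ k).
- eapply is_series_ext;
    [|exact (is_series_scal ((T - 1) ^ k / CofN (fact k)) _ _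
               (is_Cseries_negbin k Q HQ))].
  intros m; unfold scal; simpl; unfold mult; simpl; ring_C.
- rewrite Cpow_inv by exact HQ1; field.
  split; [apply Cpow_nz, HQ1|apply CofN_fact_neq_0].
Qed.

(** The factor [(p + j)!] cancels, [(Q - 1)^j] cancels [(1 - Q)^j] up to
    sign, and what is left is the binomial expansion of [(1 + (T - 1))^l]. *)
Lemma inner_sum_eq (T Q : C) (W : nat -> C) (p l : nat) :
  1 - Q <> 0 ->
  (forall k, W k = (T - 1) ^ k / (CofN (fact k) * (1 - Q) ^ k)) ->
  sum_n (fun j => CofN (binom l j) * (Q - 1) ^ j * CofN (fact (p + j)) *
    (- (1)) ^ (p + j) * W (p + j)%nat) l =
  (1 - T) ^ p / (1 - Q) ^ p * T ^ l.
Proof.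
intros HQ HW.
replace (T ^ l) with ((1 + (T - 1)) ^ l) by (f_equal; ring).
rewrite <- binomial_sum_one; unfold binomial_sum.
rewrite <- sum_n_C_mult_l; apply sum_n_ext; intros j.
rewrite HW, !Cpow_add_r, Cpow_1_l.
replace ((1 - T) ^ p) with ((- (1)) ^ p * (T - 1) ^ p)
  by (rewrite <- Cpow_mult_l; f_equal; ring).
replace ((Q - 1) ^ j) with ((- (1)) ^ j * (1 - Q) ^ j)
  by (rewrite <- Cpow_mult_l; f_equal; ring).
assert (Hsq : (- (1)) ^ j * (- (1)) ^ j = 1)
  by (rewrite <- Cpow_mult_l; replace (- (1) * - (1)) with (RtoC 1) by ring;
      apply Cpow_1_l).
assert (Hf := CofN_fact_neq_0 (p + j)).
assert (HQ1 := Cpow_nz _ j HQ); assert (HQ2 := Cpow_nz _ p HQ).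
(* The two factors [(-1)^j], from [(Q - 1)^j] and from the sign, are kept
   together: [field] does not know that they cancel. *)
transitivity ((- (1)) ^ j * (- (1)) ^ j *
  (CofN (binom l j) * ((- (1)) ^ p * (T - 1) ^ p) /
     (1 - Q) ^ p * (T - 1) ^ j)).
- change (AbelianMonoid.sort C_AbelianMonoid) with C; field; auto.
- rewrite Hsq; change (AbelianMonoid.sort C_AbelianMonoid) with C; field; auto.
Qed.

Theorem theorem9 :
  forall (q logq : C),
    (0 < Cmod q < 1)%R -> Cexp logq = q ->
  forall (alpha beta : nat), (0 < alpha)%nat -> (0 < beta)%nat ->
  forall (N d : nat) (chi : Z -> C),
    dirichlet_character N chi -> conductor N chi d -> Nat.Odd d ->
  forall (n : nat) (x : C),
    let term (k m r : nat) : C :=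
      CofN (binom (k + m - 1) m) * CofN alpha ^ r * q ^ (alpha * m) *
      logq ^ r * RtoC (stirling2 r k) * (x ^ r / CofN (fact r)) in
    (forall l j : nat, (l <= n)%nat -> (j <= l)%nat ->
       (forall m : nat, Cex_series (fun r => term (n - l + j)%nat m r)) /\
       Cex_series (fun m => CSeries (fun r => term (n - l + j)%nat m r))) /\
    qEuler q logq chi d alpha beta n x =
    sum_n (fun l : nat =>
      CofN (binom n l) * qEuler_number q logq chi d alpha beta l *
      sum_n (fun j : nat =>
        CofN (binom l j) * (q ^ alpha - 1) ^ j * CofN (fact (n - l + j)) *
        (- (1)) ^ (n - l + j) *
        CSeries (fun m => CSeries (fun r => term (n - l + j)%nat m r))) l) n.
Proof.
intros q logq [_ Hq] _ alpha beta Halpha _ N d chi _ _ _ n x term.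
set (T := qpow logq (CofN alpha * x)); set (Q := q ^ alpha).
set (W := fun k => (T - 1) ^ k / (CofN (fact k) * (1 - Q) ^ k)).
assert (HQ : (Cmod Q < 1)%R).
{ unfold Q; rewrite Cmod_pow; apply pow_lt_1_compat;
    [split; [apply Cmod_ge_0|exact Hq]|exact Halpha]. }
assert (HQ1 := one_minus_neq_0 Q HQ).
assert (Hinner := fun k m => double_series_inner q logq x alpha k m :
  is_Cseries (term k m) _).
assert (Houter : forall k,
  is_Cseries (fun m => CSeries (fun r => term k m r)) (W k)).
{ intros k.
  apply is_series_ext with (2 := double_series_outer T Q k HQ).
  intros m; symmetry; apply CSeries_unique, Hinner. }
split.
- intros l j _ _; split; [intros m|]; eexists; [apply Hinner|apply Houter].
- rewrite qEuler_eq_binomial_sum.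
  set (c := fun j : nat => _ : C); fold T Q.
  set (A := qbracket 2 (q ^ beta)).
  replace (binomial_sum 1 T c n) with
    (binomial_sum (1 - T) T (binomial_sum 1 1 c) n).
  2: { rewrite binomial_sum_comp; f_equal; ring. }
  unfold binomial_sum at 1; rewrite <- sum_n_C_mult_l.
  apply sum_n_ext_loc; intros l Hl.
  rewrite (inner_sum_eq T Q
    (fun k => CSeries (fun m => CSeries (fun r => term k m r))) (n - l) l HQ1)
    by (intros k; apply CSeries_unique, Houter).
  unfold qEuler_number; rewrite qEuler_eq_binomial_sum; fold c Q A.
  replace (qpow logq (CofN alpha * 0)) with (RtoC 1).
  2: { unfold qpow; rewrite Cmult_0_r, Cmult_0_l; symmetry; apply Cexp_0. }
  assert (HQn := Cpow_nz _ (n - l) HQ1); assert (HQl := Cpow_nz _ l HQ1).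
  replace ((1 - Q) ^ n) with ((1 - Q) ^ (n - l) * (1 - Q) ^ l)
    by (rewrite <- Cpow_add_r; f_equal; lia).
  change (AbelianMonoid.sort C_AbelianMonoid) with C; field; auto.
Qed.
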